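(* Let $G$ be a tree on $n\ge 4$ vertices, with complement $\overline{G}$. If $G$ is not $K_{1,3}$ or $K_{1,4}$, then $$\gamma_P(G)\cdot\gamma_P(\overline{G})\le\left\lfloor\frac{n}{3}\right\rfloor,$$ and this bound is attained for arbitrarily large $n$.
   Context: All graphs are finite, simple, undirected, with nonempty vertex set. $N(v)$ is the set of neighbors of $v$, $N[v]=N(v)\cup\{v\}$, and $N[S]=\bigcup_{v\in S}N[v]$. For $S\subseteq V(G)$, define $PD(S)$ by: (1) start with $PD(S):=N[S]$; (2) while there exists $v\in PD(S)$ with $|N(v)\setminus PD(S)|=1$, set $PD(S):=PD(S)\cup N(v)$. $S$ is a power dominating set if $PD(S)=V(G)$ at the end of the process. The power domination number $\gamma_P(G)$ is the minimum cardinality of a power dominating set of $G$. $K_{p,q}$ is the complete bipartite graph with partite sets of cardinality $p$ and $q$. *)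

(* Defs.v *)
From mathcomp Require Import all_boot.

Set Implicit Arguments.
Unset Strict Implicit.
Unset Printing Implicit Defensive.

Record sgraph := SGraph {
  vertex :> finType;
  edge : rel vertex;
  edge_sym : symmetric edge;
  edge_irr : irreflexive edge }.

Section Graph.
Variable G : sgraph.

Definition compl_edge : rel G := [rel x y | (x != y) && ~~ edge x y].

Lemma compl_edge_sym : symmetric compl_edge.
Proof. by move=> x y; rewrite /compl_edge /= (eq_sym x) edge_sym. Qed.

Lemma compl_edge_irr : irreflexive compl_edge.
Proof. by move=> x; rewrite /compl_edge /= eqxx. Qed.

Definition compl : sgraph := SGraph compl_edge_sym compl_edge_irr.

Definition connected : Prop := forall x y : G, connect (@edge G) x y.

(* A graph cycle is a [ucycle] with at least three vertices: [ucycle] also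
   holds of [::] and of [:: x; y] for any edge xy. *)
Definition acyclic : Prop :=
  forall c : seq G, 2 < size c -> ~ ucycle (@edge G) c.

Definition is_tree : Prop := [/\ 0 < #|G|, connected & acyclic].

Definition nbh (v : G) : {set G} := [set w | edge v w].
Definition closed_nbh (v : G) : {set G} := v |: nbh v.
Definition closed_nbhs (S : {set G}) : {set G} := \bigcup_(v in S) closed_nbh v.

(* One turn of the while loop, with an arbitrary choice of v; the identity once
   no such v is left. *)
Definition pd_step (A : {set G}) : {set G} :=
  if [pick v in A | #|nbh v :\: A| == 1] is Some v then A :|: nbh v else A.

(* Every effective step adds a vertex, so #|G| iterations reach the end of the
   loop (lemma [PD_final]); the result does not depend on the choices made in
   [pd_step] (lemmas [PD_start], [PD_final] and [PD_least]). *)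
Definition PD (S : {set G}) : {set G} := iter #|G| pd_step (closed_nbhs S).

Definition power_dominating (S : {set G}) : bool := PD S == [set: G].

(* [set: G] is power dominating (lemma [power_dominating_setT]), so this is a
   genuine minimum. *)
Definition gammaP : nat :=
  #|[arg min_(S < [set: G] | power_dominating S) #|S|]|.

Lemma sub_pd_step (A : {set G}) : A \subset pd_step A.
Proof. by rewrite /pd_step; case: pickP => // v _; apply: subsetUl. Qed.

Lemma sub_iter_pd_step k (A : {set G}) : A \subset iter k pd_step A.
Proof. by elim: k => //= k IH; apply: subset_trans IH (sub_pd_step _). Qed.

Lemma PD_start S : closed_nbhs S \subset PD S.
Proof. exact: sub_iter_pd_step. Qed.

Lemma pd_step_fixed (A : {set G}) v :
  pd_step A = A -> v \in A -> #|nbh v :\: A| != 1.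
Proof.
rewrite /pd_step; case: pickP => [w /andP[_ /eqP Nw] AE _|noV _ vA].
  suff NA0 : nbh w :\: A = set0 by rewrite NA0 cards0 in Nw.
  by apply/eqP; rewrite setD_eq0 -AE subsetUr.
by have := noV v; rewrite vA /= => ->.
Qed.

Lemma PD_final S v : v \in PD S -> #|nbh v :\: PD S| != 1.
Proof.
apply: pd_step_fixed; rewrite /PD; set B := closed_nbhs S.
have grow k : iter k.+1 pd_step B = iter k pd_step B \/
    k < #|iter k.+1 pd_step B|.
  elim: k => [|k [IH|IH]]; first 1 last.
  - by left; rewrite iterS IH -iterS.
  - case: (eqVneq (iter k.+2 pd_step B) (iter k.+1 pd_step B)); first by left.
    move=> neq; right; apply: (leq_ltn_trans IH); apply: proper_card.
    by rewrite properEneq eq_sym neq iterS sub_pd_step.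
  case: (eqVneq (iter 1 pd_step B) B); first by left.
  move=> neq; right; apply: (leq_ltn_trans (leq0n #|B|)).
  by apply: proper_card; rewrite properEneq eq_sym neq sub_pd_step.
by case: (grow #|G|) => //; rewrite ltnNge max_card.
Qed.

Lemma PD_least S (A : {set G}) :
    closed_nbhs S \subset A -> (forall v, v \in A -> #|nbh v :\: A| != 1) ->
  PD S \subset A.
Proof.
move=> SA clA; rewrite /PD; elim: #|G| => //= k.
move: (iter k _ _) => B BA; rewrite /pd_step; case: pickP => // v.
case/andP=> vB /eqP NvB; rewrite subUset BA -setD_eq0 -cards_eq0.
have le1 : #|nbh v :\: A| <= 1 by rewrite -NvB subset_leq_card ?setDS.
by case: #|_ :\: A| le1 (clA v (subsetP BA v vB)) => [|[]].
Qed.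

Lemma power_dominating_setT : power_dominating [set: G].
Proof.
rewrite /power_dominating eqEsubset subsetT /=.
apply: subset_trans (PD_start _); apply/subsetP => v _.
by apply/bigcupP; exists v; rewrite ?inE ?eqxx.
Qed.

End Graph.

Section CompleteBipartite.
Variables p q : nat.

Definition Kedge : rel ('I_p + 'I_q) := fun x y =>
  match x, y with inl _, inr _ | inr _, inl _ => true | _, _ => false end.

Lemma Kedge_sym : symmetric Kedge. Proof. by case=> x []. Qed.
Lemma Kedge_irr : irreflexive Kedge. Proof. by case. Qed.

Definition complete_bipartite : sgraph := SGraph Kedge_sym Kedge_irr.
End CompleteBipartite.

Definition isomorphic (G H : sgraph) : Prop :=
  exists2 f : G -> H, bijective f & forall x y, edge (f x) (f y) = edge x y.

(* Main.v *)
(* If a leaf [v] of [G] has a neighbour [u] that is not adjacent to all other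
   vertices, then in the complement [[set v]] dominates everything but [u], and
   [u] is forced; so [gammaP (compl G) <= 1], and what remains is the bound
   [gammaP G <= n / 3], valid for every connected graph on at least three
   vertices. If [u] is adjacent to all other vertices, [G] is a star and the
   product is at most 2.
   For the bound, take among the power dominating sets without leaves one that
   is lexicographically minimal for its size and the number of its members with
   no neighbour in the set. An exchange argument shows that each member has two
   private neighbours; a member and its private neighbours form blocks of size
   at least 3, and these are disjoint. Equality holds for trees in which each
   vertex of a subtree has exactly two pendant leaves. *)

Require Import Defs.
From mathcomp Require Import all_boot.

Set Implicit Arguments.
Unset Strict Implicit.
Unset Printing Implicit Defensive.

(** * Forcing, private neighbours and exchange in an arbitrary graph *)

Section PowerDomination.
Variable G : sgraph.
Implicit Types (S A : {set G}) (u v w x y : G).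

Lemma closed_nbhsP S x :
  reflect (exists2 v, v \in S & (x == v) || edge v x) (x \in closed_nbhs S).
Proof.
apply: (iffP bigcupP) => -[v vS xv]; exists v => //; move: xv;
  by rewrite !inE.
Qed.

Lemma closed_nbhsS S A : S \subset A -> closed_nbhs S \subset closed_nbhs A.
Proof.
move=> /subsetP SA; apply/subsetP=> x /closed_nbhsP[v vS xv].
by apply/closed_nbhsP; exists v => //; apply: SA.
Qed.

Lemma gammaP_le S : power_dominating S -> gammaP G <= #|S|.
Proof.
rewrite /gammaP; case: arg_minnP; first exact: power_dominating_setT.
by move=> A _; apply.
Qed.

Lemma gammaP_ge k :
  (forall S, power_dominating S -> k <= #|S|) -> k <= gammaP G.
Proof.
move=> ge_k; rewrite /gammaP; case: arg_minnP => [|A PA _].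
  exact: power_dominating_setT.
exact: ge_k.
Qed.

(** The source of lower bounds: a proper subset from which nothing can be forced traps the
    process. *)
Lemma closed_power_dominating S A :
    power_dominating S -> closed_nbhs S \subset A ->
  (forall v, v \in A -> #|nbh v :\: A| != 1) -> A = [set: G].
Proof.
move=> /eqP PDS SA clA; apply/eqP; rewrite eqEsubset subsetT -PDS.
exact: PD_least.
Qed.

Lemma power_dominating_trans S A :
  power_dominating S -> closed_nbhs S \subset PD A -> power_dominating A.
Proof.
move=> PS SA; apply/eqP; apply: closed_power_dominating PS SA _.
exact: PD_final.
Qed.

Lemma PD_force S v : v \in PD S -> #|nbh v :\: PD S| <= 1 -> nbh v \subset PD S.
Proof.
move=> /PD_final; rewrite -setD_eq0 -cards_eq0.
by case: #|_| => [|[]].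
Qed.

Lemma dominating_power_dominating S :
  closed_nbhs S = [set: G] -> power_dominating S.
Proof.
by move=> domS; rewrite /power_dominating eqEsubset subsetT -domS PD_start.
Qed.

Lemma gammaP_gt0 : 0 < #|G| -> 0 < gammaP G.
Proof.
move=> G_gt0; apply: gammaP_ge => S PS; rewrite card_gt0; apply/eqP=> S0.
have := @closed_power_dominating S set0 PS.
rewrite S0 /closed_nbhs big_set0 sub0set => /(_ isT) G0.
suff set0T : set0 = [set: G] by rewrite -cardsT -set0T cards0 in G_gt0.
by apply: G0 => v; rewrite inE.
Qed.

(** External private neighbours: [v] is not counted, and the other members of [S] are removed along
    with what they dominate. *)
Definition private_nbh S v : {set G} := nbh v :\: closed_nbhs (S :\ v).

(** Every neighbour of [v] missing from [PD A] is private, so at most one is missing and the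
    observed vertex [v] forces it. Hence [PD A] contains all that [S] dominates. *)
Lemma power_dominating_exchange S A v :
    power_dominating S -> S :\ v \subset A -> v \in closed_nbhs A ->
  #|private_nbh S v| <= 1 -> power_dominating A.
Proof.
move=> PS SA vA pv; apply: power_dominating_trans PS _.
have vPD := subsetP (PD_start A) _ vA.
have SvPD : closed_nbhs (S :\ v) \subset PD A.
  exact: subset_trans (closed_nbhsS SA) (PD_start A).
have NvPD : nbh v \subset PD A.
  apply: PD_force => //; apply: leq_trans pv.
  by rewrite subset_leq_card ?setDS.
apply/subsetP=> x /closed_nbhsP[w wS xw].
have [wv|wv] := eqVneq w v; last first.
  apply: (subsetP SvPD); apply/closed_nbhsP; exists w => //.
  by rewrite !inE wv.
move: xw; rewrite wv => /orP[/eqP-> //|vx].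
by apply: (subsetP NvPD); rewrite inE.
Qed.

(** * The bound of one third of the order for connected graphs *)

Definition lonely S : {set G} := [set v in S | [disjoint nbh v & S]].

Lemma private_nbh_block_bound S :
  {in S, forall v, 1 < #|private_nbh S v|} -> 3 * #|S| <= #|G|.
Proof.
move=> pn2; pose B v := v |: private_nbh S v.
have notS v u : v \in S -> u \in S -> v != u -> v \notin B u.
  move=> vS uS vu; rewrite !inE (negPf vu) /= negb_and negbK; apply/orP; left.
  by apply/closed_nbhsP; exists v; rewrite ?eqxx // !inE vu.
have disjB : {in S &, forall v u, v != u -> [disjoint B v & B u]}.
  move=> v u vS uS vu; rewrite disjoint_subset; apply/subsetP=> x xBv.
  rewrite inE; apply/negP=> xBu.
  have [xv|xv] := eqVneq x v.
    by rewrite xv (negPf (notS _ _ vS uS vu)) in xBu.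
  have [xu|xu] := eqVneq x u.
    by rewrite xu (negPf (notS _ _ uS vS _)) // eq_sym in xBv.
  move: xBv xBu; rewrite !inE (negPf xv) (negPf xu) /= => /andP[_ vx].
  case/andP=> /negP[]; apply/closed_nbhsP; exists v; rewrite ?vx ?orbT //.
  by rewrite !inE vu.
have block3 v : v \in S -> 3 <= \sum_(x in B v) 1.
  move=> vS; rewrite sum1_card cardsU1 -[3]/(1 + 2) leq_add ?pn2 //.
  by rewrite !inE edge_irr andbF.
(* Double counting of the pairs of a block and a vertex in it: at least three per block, at most one
   per vertex. *)
rewrite mulnC -sum_nat_const.
apply: (@leq_trans (\sum_(v in S) \sum_(x in B v) 1)); first exact: leq_sum.
rewrite (exchange_big_dep predT) //= -sum1_card; apply: leq_sum => x _.
rewrite sum1dep_card; apply/card_le1_eqP => v u.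
rewrite !inE => /andP[vS xv] /andP[uS xu]; apply/eqP/negPn/negP=> uv.
have /pred0P/(_ x) := disjB _ _ uS vS uv.
by rewrite /= !inE in xv xu *; rewrite xv xu.
Qed.

Lemma connected_closed A x :
    connected G -> x \in A -> (forall u v, u \in A -> edge u v -> v \in A) ->
  A = [set: G].
Proof.
move=> conG xA clA; apply/setP=> y; rewrite inE.
have clAE : closed (@edge G) (mem A).
  apply: intro_closed; first exact: sym_connect_sym (@edge_sym G).
  by move=> u v uv uA; apply: clA uv.
by rewrite -(closed_connect clAE (conG x y)).
Qed.

Definition core : {set G} := [set v | 1 < #|nbh v|].

(** A vertex outside [core] has at most one neighbour. If it has none, or if that neighbour is
    outside [core] too, they form a component of at most two vertices. *)
Lemma core_dominating :
  connected G -> 2 < #|G| -> closed_nbhs core = [set: G].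
Proof.
move=> conG G_gt2; apply/setP=> x; rewrite inE; apply/closed_nbhsP.
have [xcore|] := boolP (x \in core); first by exists x; rewrite ?eqxx.
rewrite inE -leqNgt => dx.
have [u xu|noN] := pickP (edge x); last first.
  suff x1 : [set x] = [set: G] by rewrite -cardsT -x1 cards1 in G_gt2.
  apply: (@connected_closed _ x) => // [|y v]; first by rewrite !inE.
  by rewrite inE => /eqP->; rewrite noN.
have Nx v : edge x v -> v = u.
  by move=> xv; apply: (card_le1_eqP dx); rewrite inE.
exists u; last by rewrite edge_sym xu orbT.
rewrite inE ltnNge; apply/negP=> du.
suff xuT : [set x; u] = [set: G].
  by rewrite -cardsT -xuT cards2 ltnNge ltnS leq_b1 in G_gt2.
apply: (@connected_closed _ x) => // [|y v]; first by rewrite !inE eqxx.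
rewrite !inE => /orP[]/eqP->; first by move/Nx->; rewrite eqxx orbT.
move=> uv; apply/orP; left; apply/eqP.
by apply: (card_le1_eqP du); rewrite inE // edge_sym.
Qed.

Lemma gammaP_third : connected G -> 2 < #|G| -> gammaP G <= #|G| %/ 3.
Proof.
move=> conG G_gt2.
pose P S := power_dominating S && (S \subset core).
(* The factor exceeds every value of [#|lonely S|], so comparing weights is the lexicographic
   comparison. *)
pose weight S := #|S| * #|G|.+1 + #|lonely S|.
have Pcore : P core.
  rewrite /P subxx andbT; apply: dominating_power_dominating.
  exact: core_dominating.
have [S /andP[PS Score] minS] := arg_minnP weight Pcore.
apply: leq_trans (gammaP_le PS) _; rewrite leq_divRL // mulnC.
apply: private_nbh_block_bound => v vS; rewrite ltnNge; apply/negP=> pv.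
have [vlonely|/pred0Pn[u /andP[/= vu uS]]] := boolP [disjoint nbh v & S].
  (* [v] has a non-private neighbour [w]; it is adjacent to some [u] in
     [S :\ v], so exchanging [v] for [w] decreases [lonely]. *)
  have [w] : exists w, w \in nbh v :\: private_nbh S v.
    apply/set0Pn; rewrite -card_gt0 cardsD subn_gt0.
    apply: leq_ltn_trans (leq_trans (subset_leq_card (subsetIr _ _)) pv) _.
    by have := subsetP Score v vS; rewrite inE.
  rewrite !inE => /andP[]; case vw: (edge v w); rewrite ?andbF // !andbT negbK.
  have wS : w \notin S.
    apply/negP=> wS; have /pred0P/(_ w) := vlonely.
    by rewrite /= inE vw wS.
  case/closed_nbhsP=> u; rewrite !inE => /andP[uv uS] wu _.
  have {wu} uw : edge u w.
    by case/orP: wu => // /eqP wu; rewrite wu uS in wS.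
  (* [w] dominates [v], and it lies in [core] because [u] and [v] are two distinct neighbours of
     it. *)
  have Pw : P (w |: (S :\ v)).
    apply/andP; split.
      apply: (power_dominating_exchange PS (subsetUr _ _) _ pv).
      apply/closed_nbhsP; exists w; first by rewrite !inE eqxx.
      by rewrite edge_sym vw orbT.
    rewrite subUset sub1set (subset_trans (subD1set _ _) Score) andbT inE.
    rewrite ltnNge; apply/negP=> /card_le1_eqP/(_ u v).
    by rewrite !inE !(edge_sym w) uw vw => /(_ isT isT) E; rewrite E eqxx in uv.
  have := minS _ Pw; rewrite /weight leqNgt => /negP[].
  have -> : #|w |: (S :\ v)| = #|S|.
    by rewrite cardsU1 (cardsD1 v S) vS !inE (negPf wS) andbF.
  (* The new member [w] is not lonely, since [u] remains. No other member becomes lonely, since the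
     removed [v] had no neighbour in [S]. The lonely [v] itself is gone. *)
  rewrite ltn_add2l; apply: proper_card; apply/properP; split.
    apply/subsetP=> x; rewrite !inE => /andP[xS' xlonely].
    have nxS' y : edge x y -> y \notin w |: (S :\ v).
      move=> xy; apply/negP=> yS'; have /pred0P/(_ y) := xlonely.
      by rewrite /= inE xy yS'.
    have [xw|xw] := eqVneq x w.
      have := nxS' u; rewrite xw edge_sym uw => /(_ isT).
      by rewrite !inE uv uS orbT.
    move: xS'; rewrite (negPf xw) /= => /andP[xv xS]; rewrite xS /=.
    rewrite disjoint_subset; apply/subsetP=> y; rewrite !inE => xy.
    apply/negP=> yS; have := nxS' y xy; rewrite !inE yS andbT negb_or negbK.
    case/andP=> _ /eqP yv; have /pred0P/(_ x) := vlonely.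
    by rewrite /= inE edge_sym -yv xy xS.
  exists v; first by rewrite inE vS.
  rewrite !inE eqxx /= orbF negb_and; apply/orP; left.
  by apply/eqP=> E; rewrite -E vS in wS.
(* Here [v] has a neighbour [u] in [S], which still dominates [v] after its deletion. *)
have Pv : P (S :\ v).
  rewrite /P (subset_trans (subD1set _ _) Score) andbT.
  apply: (power_dominating_exchange PS (subxx _) _ pv).
  rewrite inE in vu; apply/closed_nbhsP; exists u.
    by rewrite !inE uS andbT; apply: contraTneq vu => ->; rewrite edge_irr.
  by rewrite edge_sym vu orbT.
have := minS _ Pv; rewrite /weight leqNgt (cardsD1 v S) vS => /negP[].
by rewrite mulSnr ltn_addr // ltn_add2l ltnS max_card.
Qed.

(** A path is extended at its head [x] while possible; [k] bounds the extensions left. At the end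
    every neighbour of [x] is on the path, and one beyond [y] would close a cycle. *)
Lemma acyclic_leaf :
  acyclic G -> (exists x y : G, edge x y) ->
  exists v u, edge v u /\ forall w, edge v w -> w = u.
Proof.
move=> acG [x0 [y0 x0y0]].
suff leaf k x y p : path (@edge G) x (y :: p) -> uniq (x :: y :: p) ->
    #|G| - size p <= k -> exists v u, edge v u /\ forall w, edge v w -> w = u.
  apply: (leaf _ x0 y0 [::]) (leqnn _); rewrite /= ?x0y0 // inE andbT.
  by apply: contraTneq x0y0 => ->; rewrite edge_irr.
elim: k x y p => [|k IH] x y p xp Up.
  rewrite leqn0 subn_eq0 leqNgt => /negP[].
  by apply: leq_trans (max_card (mem (x :: y :: p)));
    rewrite (card_uniqP Up) /= ltnW.
move=> lek; have [z /andP[xz zp]|maxp] :=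
  pickP (fun z => edge x z && (z \notin x :: y :: p)).
  apply: (IH z x (y :: p)); [by rewrite /= edge_sym xz | by rewrite /= zp | ].
  by rewrite /= subnS -ltnS (leq_trans _ lek) // prednK // subn_gt0;
    apply: leq_trans (max_card (mem (x :: y :: p)));
    rewrite (card_uniqP Up) /= ltnW.
exists x, y; split=> [|w xw]; first by case/andP: xp.
have := maxp w; rewrite xw /= => /negbFE; rewrite !inE.
case/or3P=> [/eqP wx|/eqP//|wp].
  by rewrite wx edge_irr in xw.
case/splitPr: wp xp Up {lek maxp} => p1 p2 xp Up.
case: (acG (x :: y :: rcons p1 w)); first by rewrite /= size_rcons.
move: xp Up; rewrite -cat_rcons -2!cat_cons cat_path cat_uniq.
case/andP=> xp _ /andP[Up _].
rewrite /ucycle /ucycleb Up andbT /= rcons_path last_rcons.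
rewrite (edge_sym w) xw andbT.
exact: xp.
Qed.

End PowerDomination.

(** * Complements of graphs with a leaf, and stars *)

Section Star.
Variable G : sgraph.
Implicit Types u v w x y z : G.

Lemma gammaP_compl_leaf v u z :
    (forall w, edge v w -> w = u) -> z != u -> ~~ edge u z ->
  gammaP (compl G) <= 1.
Proof.
move=> leaf zu zNu; rewrite -(cards1 v); apply: (@gammaP_le (compl G)).
set PDv := PD (G := compl G) [set v].
have sub w : w != u -> w \in PDv.
  move=> wu; apply: (subsetP (PD_start (G := compl G) _)).
  apply/(closed_nbhsP (G := compl G)); exists v; first by rewrite inE.
  have [->|wv] := eqVneq w v; first by apply/orP; left.
  rewrite /= /compl_edge /= eq_sym wv /=.
  by apply: contraNN wu => /leaf->.
(* In the complement [z] is adjacent to [u], the only vertex that may still be unobserved, so [z]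
   forces it. *)
have NzPD : nbh (G := compl G) z \subset PDv.
  apply: (PD_force (G := compl G)); first exact: sub.
  rewrite -(cards1 u); apply: subset_leq_card; apply/subsetP=> w.
  by rewrite in_set1 inE => /andP[wPD _]; apply: contraNT wPD => /sub.
apply/eqP/setP=> w; rewrite inE; have [->|/sub//] := eqVneq w u.
by apply: (subsetP NzPD); rewrite inE /= /compl_edge /= zu edge_sym.
Qed.

Definition universal u := forall x, x != u -> edge u x.

Lemma gammaP_universal u : universal u -> gammaP G <= 1.
Proof.
move=> uniu; rewrite -(cards1 u); apply: gammaP_le.
apply: dominating_power_dominating; apply/setP=> x; rewrite inE.
apply/closed_nbhsP; exists u; first by rewrite inE.
by case: eqVneq => //= /uniu.
Qed.

Lemma gammaP_compl_leaf2 v u :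
  (forall w, edge v w -> w = u) -> gammaP (compl G) <= 2.
Proof.
move=> leaf; apply: (@leq_trans #|[set u; v]|); last first.
  by rewrite cards2 ltnS leq_b1.
apply: (@gammaP_le (compl G)); apply: dominating_power_dominating.
apply/setP=> x; rewrite inE; apply/(closed_nbhsP (G := compl G)).
have [->|xu] := eqVneq x u; first by exists u; rewrite ?eqxx // !inE eqxx.
exists v; first by rewrite !inE eqxx orbT.
have [->|xv] := eqVneq x v; first by apply/orP; left.
rewrite /= /compl_edge /= eq_sym xv /=.
by apply: contraNN xu => /leaf->.
Qed.

(** Two adjacent vertices other than [u] would form a triangle with it. The order is written [q.+2]
    so that some vertex differs from [u], as [enum_rank_in] requires. *)
Lemma star_isomorphic q u :
    acyclic G -> universal u -> #|G| = q.+2 ->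
  isomorphic G (complete_bipartite 1 q.+1).
Proof.
move=> acG uniu cG; pose A := [set~ u].
have cA : #|A| = q.+1 by rewrite cardsC1 cG.
have /card_gt0P[v vA] : 0 < #|A| by rewrite cA.
pose f (x : G) : complete_bipartite 1 q.+1 :=
  if x == u then inl ord0 else inr (cast_ord cA (enum_rank_in vA x)).
have fK : injective f.
  move=> x y; rewrite /f; case: eqVneq => [->|xu]; case: eqVneq => [->|yu] //.
  case=> /ord_inj/enum_rank_in_inj; apply; by rewrite !inE.
exists f; first by apply: inj_card_bij => //; rewrite card_sum !card_ord cG.
move=> x y; rewrite /f.
case: eqVneq => [->|xu]; case: eqVneq => [->|yu] /=.
- by rewrite edge_irr.
- by rewrite uniu.
- by rewrite edge_sym uniu.
apply/esym/negP=> xy; apply: (acG [:: u; x; y]) => //.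
rewrite /ucycle /ucycleb /= !inE uniu // xy (edge_sym y) uniu //= negb_or.
rewrite !(eq_sym u) xu yu /= andbT; apply: contraTneq xy => ->.
by rewrite edge_irr.
Qed.

End Star.

Lemma tree_gammaP_compl (G : sgraph) :
    3 < #|G| -> is_tree G ->
    ~ isomorphic G (complete_bipartite 1 3) ->
    ~ isomorphic G (complete_bipartite 1 4) ->
  gammaP G * gammaP (compl G) <= #|G| %/ 3.
Proof.
move=> G_gt3 [_ conG acG] not13 not14.
have G_gt2 := ltnW G_gt3; have bound := gammaP_third conG G_gt2.
have [v [u [vu leaf]]] : exists v u : G,
    edge v u /\ forall w, edge v w -> w = u.
  apply: acyclic_leaf => //.
  have /card_gt0P[x] : 0 < #|core G|.
    rewrite card_gt0; apply/eqP=> core0; have := core_dominating conG G_gt2.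
    rewrite core0 /closed_nbhs big_set0 => set0T.
    by rewrite -cardsT -set0T cards0 in G_gt2.
  rewrite inE => /ltnW/card_gt0P[y]; rewrite inE => xy.
  by exists x, y.
have [z /andP[zu uz]|uniu] := pickP (fun z => (z != u) && ~~ edge u z).
  apply: leq_trans bound; rewrite -[leqRHS]muln1 leq_mul2l.
  by rewrite (gammaP_compl_leaf leaf zu uz) orbT.
have {}uniu : universal u.
  by move=> x xu; have := uniu x; rewrite xu /= => /negbFE.
apply: (@leq_trans (1 * 2)).
  by rewrite leq_mul ?(gammaP_universal uniu) ?(gammaP_compl_leaf2 leaf).
(* A product of at most 2 is fine from six vertices on; orders 4 and 5 leave only the two excluded
   stars. *)
rewrite leq_divRL // leqNgt; apply/negP=> G_lt6.
have star q := @star_isomorphic G q u acG uniu.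
case: #|G| (star) G_gt3 G_lt6 => [|[|[|[|[|[|n]]]]]] // {}star _ _.
  by apply: not13; apply: star.
by apply: not14; apply: star.
Qed.

(** * Trees given by a parent function *)

Section ParentGraph.
Variables (T : finType) (parent : T -> T).

(** The root is its own parent; [x != y] discards the resulting loop. *)
Definition parent_edge : rel T :=
  [rel x y | (x != y) && ((parent x == y) || (parent y == x))].

Lemma parent_edge_sym : symmetric parent_edge.
Proof. by move=> x y; rewrite /parent_edge /= eq_sym orbC. Qed.

Lemma parent_edge_irr : irreflexive parent_edge.
Proof. by move=> x; rewrite /parent_edge /= eqxx. Qed.

Definition parent_graph : sgraph := SGraph parent_edge_sym parent_edge_irr.

(* Both neighbours on a cycle of a vertex of maximal rank are its parent. *)
Lemma parent_graph_tree (rank : T -> nat) r :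
    parent r = r -> (forall x, x != r -> rank (parent x) < rank x) ->
  is_tree parent_graph.
Proof.
move=> pr rankP; have symG := sym_connect_sym parent_edge_sym.
split; first by apply/card_gt0P; exists r.
  have to_root x : connect parent_edge x r.
    elim/ltn_ind: {x}(rank x) {-2}x (erefl (rank x)) => n IH x rx.
    have [->|xr] := eqVneq x r; first exact: connect0.
    apply: connect_trans (IH _ _ _ (erefl (rank (parent x)))).
      apply: connect1; rewrite /parent_edge /= eqxx andbT.
      by apply: contraTneq (rankP x xr) => <-; rewrite ltnn.
    by rewrite -rx rankP.
  move=> x y; apply: connect_trans (to_root x) _.
  by rewrite [connect _ _ _]symG.
move=> [//|z c] c_gt2 /andP[cyc Uc].
case: (@arg_maxnP _ z (mem (z :: c)) rank (mem_head z c)) => x xc maxx.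
have up y : y \in z :: c -> parent_edge x y -> y = parent x.
  rewrite /parent_edge /= => yc /andP[xy /orP[/eqP//|/eqP py]].
  have yr : y != r by apply: contraNneq xy => yr; rewrite -py yr pr.
  by have := rankP y yr; rewrite py ltnNge => /negP[]; apply: maxx.
(* Rotated to start at [x], the cycle has the two neighbours of [x] as its second and last entries,
   which [up] makes equal. *)
have [i p cE] := rot_to xc.
have memE : x :: p =i z :: c by rewrite -cE; apply: mem_rot.
move: c_gt2 cyc Uc; rewrite -(size_rot i) -(rot_cycle i) -(rot_uniq i) cE.
case: p {cE} memE => [|y p] //; case: (lastP p) => [|{}p w] // memE _.
rewrite /= rcons_path last_rcons mem_rcons => /and3P[xy _ wx].
case/and3P=> _ yw _; move: yw; rewrite inE negb_or => /andP[/eqP[]].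
have {}yw : parent_edge x w by rewrite parent_edge_sym.
transitivity (parent x); last apply/esym; apply: up => //; rewrite -memE !inE.
  by rewrite eqxx orbT.
by rewrite mem_rcons inE eqxx !orbT.
Qed.

End ParentGraph.

(** * The extremal family *)

Section DoubleCorona.
Variable k : nat.

(* The star on the vertices [(i, 0)], with center [(0, 0)], to each of which the
   two leaves [(i, 1)] and [(i, 2)] are attached. *)
Definition corona_parent (x : 'I_k.+1 * 'I_3) : 'I_k.+1 * 'I_3 :=
  if x.2 == ord0 then (ord0, ord0) else (x.1, ord0).

Definition corona : sgraph := parent_graph corona_parent.

Lemma card_corona : #|corona| = 3 * k.+1.
Proof. by rewrite card_prod !card_ord mulnC. Qed.

Lemma corona_tree : is_tree corona.
Proof.
pose rank (x : 'I_k.+1 * 'I_3) := (x.1 != ord0) + (x.2 != ord0).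
apply: (@parent_graph_tree _ _ rank (ord0, ord0)) => [|[i j]].
  by rewrite /corona_parent eqxx.
rewrite /rank /corona_parent xpair_eqE negb_and /=.
by case: (eqVneq j ord0) => /= _; rewrite ?orbF ?addn0 ?addn1 // => ->.
Qed.

Lemma corona_leaf (v x : corona) :
  x.2 != ord0 -> edge v x -> v = (x.1, ord0).
Proof.
rewrite /= /parent_edge /= /corona_parent => /negPf x2 /andP[_]; rewrite x2.
case/orP=> /eqP // vx; move: x2; rewrite -vx.
by case: ifP => /= _; rewrite eqxx.
Qed.

(** [S] must meet each of the [k.+1] triples of vertices with the same first index. If it misses
    triple [i], both leaves there stay unobserved: their only neighbour [(i, 0)] sees two unobserved
    vertices and cannot force. *)
Lemma gammaP_corona : k < gammaP corona.
Proof.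
apply: gammaP_ge => S PS.
suff S1 : [set: 'I_k.+1] \subset [set x.1 | x in S].
  rewrite -[k.+1]card_ord -cardsT.
  exact: leq_trans (subset_leq_card S1) (leq_imset_card _ _).
apply/subsetP=> i _; apply/negPn/negP=> iS.
have NS (s : corona) : s \in S -> s.1 != i.
  by move=> sS; apply: contraNneq iS => <-; apply: imset_f.
pose A : {set corona} := [set x | (x.1 != i) || (x.2 == ord0)].
pose l1 : corona := (i, @Ordinal 3 1 isT).
pose l2 : corona := (i, @Ordinal 3 2 isT).
suff AT : A = [set: corona].
  by have := in_setT l1; rewrite -AT inE eqxx.
apply: (closed_power_dominating PS) => [|v vA].
  apply/subsetP=> x /closed_nbhsP[s sS]; rewrite inE.
  case/orP=> [/eqP->|sx]; first by rewrite NS.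
  apply/norP=> -[/negPn/eqP xi x2]; have := NS s sS.
  by rewrite (corona_leaf x2 sx) xi eqxx.
have [vi|vi] := eqVneq v (i, ord0).
  suff gt1 : 1 < #|nbh v :\: A| by rewrite neq_ltn gt1 orbT.
  apply/card_gt1P; exists l1, l2; split; last by rewrite xpair_eqE andbF.
    by rewrite !inE vi /= /parent_edge /= /corona_parent /= !eqxx orbT
      xpair_eqE andbF.
    by rewrite !inE vi /= /parent_edge /= /corona_parent /= !eqxx orbT
      xpair_eqE andbF.
rewrite [nbh v :\: A](_ : _ = set0) ?cards0 //; apply/setP=> x.
rewrite in_set0 !in_setD !inE; apply/negP=> /andP[/norP[/negPn/eqP xi x2] vx].
by rewrite (corona_leaf x2 vx) xi eqxx in vi.
Qed.

End DoubleCorona.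

Lemma isomorphic_card (G H : sgraph) : isomorphic G H -> #|G| = #|H|.
Proof. by case=> f /bij_eq_card. Qed.

Theorem proposition4p8 :
  (forall (n : nat) (G : sgraph),
      4 <= n -> #|G| = n -> is_tree G ->
      ~ isomorphic G (complete_bipartite 1 3) ->
      ~ isomorphic G (complete_bipartite 1 4) ->
      gammaP G * gammaP (compl G) <= n %/ 3) /\
  (forall N : nat, exists (n : nat) (G : sgraph),
      N <= n /\ 4 <= n /\ #|G| = n /\ is_tree G /\
      ~ isomorphic G (complete_bipartite 1 3) /\
      ~ isomorphic G (complete_bipartite 1 4) /\
      gammaP G * gammaP (compl G) = n %/ 3).
Proof.
split=> [n G n_ge4 cG|N].
  by rewrite -cG in n_ge4 *; apply: tree_gammaP_compl.
(* The successor ensures at least six vertices, more than either excluded star has. *)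
have cG := card_corona N.+1; pose G := corona N.+1.
have G_gt5 : 5 < #|G| by rewrite cG !mulnS.
have notK q : q < 5 -> ~ isomorphic G (complete_bipartite 1 q).
  move=> q_lt5 /isomorphic_card E; move: G_gt5.
  by rewrite E card_sum !card_ord ltnNge add1n q_lt5.
have G_gt3 : 3 < #|G| by apply: leq_trans G_gt5.
exists #|G|, G; split; first by
  rewrite cG (leq_trans (leq_addr 2 N)) ?addn2 ?leq_pmull.
do 2![split=> //]; split; first exact: corona_tree.
have not13 := notK 3 isT; have not14 := notK 4 isT.
do 2![split=> //]; apply/eqP; rewrite eqn_leq tree_gammaP_compl //=; last first.
  exact: corona_tree.
(* The first factor alone reaches a third of the order, and the second is positive. *)
rewrite cG mulKn // -[leqLHS]muln1 leq_mul ?gammaP_corona //.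
by apply: gammaP_gt0; apply: leq_trans G_gt5.
Qed.
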